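(* Let $X$ be a finite set, let $p_X:=\Delta^+_X\,y^X$ (position set $\Delta^+_X$, and direction set $X$ at every position), and for each $N\in\mathbb{N}$ let $\mathbf{S}_N$ be the $[p_X^{\otimes N},p_X]$-coalgebra with state set $\Delta^+_N$ defined in the context. Consider the identitor $\{\mathrm{id}_{p_X}\}\to\mathbf{S}_1$ given by the unique function to the singleton $\Delta^+_1$, and, for all $N,M_1,\dots,M_N\in\mathbb{N}$, the compositor $$(\mathbf{S}_{M_1}\otimes\cdots\otimes\mathbf{S}_{M_N})\mathbin{;}\mathbf{S}_N\to\mathbf{S}_{\sum_i M_i}$$ given on states by $$\Delta^+_N\times\Delta^+_{M_1}\times\cdots\times\Delta^+_{M_N}\to\Delta^+_{\sum_i M_i},\qquad (\mu,\nu_1,\dots,\nu_N)\mapsto\mu\circ\nu:=\big((i,j)\mapsto\mu_i\,\nu_{i,j}\big),$$ where $\nu_{i,j}$ is the $j$-th component of $\nu_i$. Then these functions are maps of coalgebras and satisfy the left and right unit laws and the associativity law of a dynamic operad; that is, they define a dynamic operad with interface $p_X$.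
   Context: Notation: $f\mathbin{;}g$ denotes composition in diagrammatic order. Polynomials. A polynomial is a functor $p\colon\mathbf{Set}\to\mathbf{Set}$ isomorphic to a sum of representables, $p=\sum_{I\in p(1)}y^{p[I]}$; elements of $p(1)$ are positions and elements of $p[I]$ are directions at $I$. A map $\phi\colon p\to q$ is a natural transformation; equivalently, for each $I\in p(1)$ an element $\phi(I)\in q(1)$ and for each $j\in q[\phi(I)]$ an element $\phi(I,j)\in p[I]$. The set of maps is $\mathbf{Poly}(p,q)$. Composition of $\phi\colon p\to q$, $\psi\colon q\to r$: $I\mapsto\psi(\phi(I))$, $(I,k)\mapsto\phi(I,\psi(\phi(I),k))$. The tensor product is $p\otimes q=\sum_{(I,J)\in p(1)\times q(1)}y^{p[I]\times q[J]}$, with unit $y$; it acts on maps componentwise. The internal hom is $[p,q]=\sum_{\phi\colon p\to q}y^{\sum_{I\in p(1)}q[\phi(I)]}$. Coalgebras. A $[p,q]$-coalgebra $\mathbf{S}$ is a set $S$ of states with a function $S\to[p,q](S)$; equivalently, an action $\mathrm{act}\colon S\to\mathbf{Poly}(p,q)$, and for each $s\in S$ an update $\mathrm{upd}_s\colon\sum_{I\in p(1)}q[\mathrm{act}_s(I)]\to S$. A map of $[p,q]$-coalgebras $\mathbf{S}\to\mathbf{S}'$ is a function $f\colon S\to S'$ with $\mathrm{act}'_{f(s)}=\mathrm{act}_s$ and $\mathrm{upd}'_{f(s)}(I,j)=f(\mathrm{upd}_s(I,j))$. The coalgebra $\{\mathrm{id}_p\}$ has one state, with action $\mathrm{id}_p$.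 Composition of coalgebras. For a $[p,q]$-coalgebra $\mathbf{S}$ and a $[q,r]$-coalgebra $\mathbf{S}'$, $\mathbf{S}\mathbin{;}\mathbf{S}'$ is the $[p,r]$-coalgebra with states $S\times S'$, action $\mathrm{act}_s\mathbin{;}\mathrm{act}'_{s'}$, and update sending $(I,k)$ to $\big(\mathrm{upd}_s(I,\mathrm{act}'_{s'}(\mathrm{act}_s(I),k)),\ \mathrm{upd}'_{s'}(\mathrm{act}_s(I),k)\big)$. Tensor of coalgebras. For a $[p,q]$-coalgebra $\mathbf{S}$ and a $[p',q']$-coalgebra $\mathbf{S}'$, $\mathbf{S}\otimes\mathbf{S}'$ is the $[p\otimes p',q\otimes q']$-coalgebra with states $S\times S'$, action $\mathrm{act}_s\otimes\mathrm{act}'_{s'}$, and update $(I,I',j,j')\mapsto(\mathrm{upd}_s(I,j),\mathrm{upd}'_{s'}(I',j'))$. The empty tensor is $\{\mathrm{id}_y\}$. Dynamic operad. A dynamic operad with interface a polynomial $p$ consists of a $[p^{\otimes n},p]$-coalgebra $\mathbf{S}_n$ for each $n\in\mathbb{N}$, a coalgebra map (identitor) $\{\mathrm{id}_p\}\to\mathbf{S}_1$, and for all $n,m_1,\dots,m_n\in\mathbb{N}$ a coalgebra map (compositor) $(\mathbf{S}_{m_1}\otimes\cdots\otimes\mathbf{S}_{m_n})\mathbin{;}\mathbf{S}_n\to\mathbf{S}_{\sum_i m_i}$ (using the canonical isomorphism $p^{\otimes m_1}\otimes\cdots\otimes p^{\otimes m_n}\cong p^{\otimes\sum_i m_i}$),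 satisfying: the left and right unit laws (the composite $\mathbf{S}_n\cong\{\mathrm{id}_p\}^{\otimes n}\mathbin{;}\mathbf{S}_n\to\mathbf{S}_1^{\otimes n}\mathbin{;}\mathbf{S}_n\to\mathbf{S}_n$ and the composite $\mathbf{S}_n\cong\mathbf{S}_n\mathbin{;}\{\mathrm{id}_p\}\to\mathbf{S}_n\mathbin{;}\mathbf{S}_1\to\mathbf{S}_n$ are identities), and the associativity law (the two maps $\big(\bigotimes_{i,j}\mathbf{S}_{\ell_{i,j}}\big)\mathbin{;}\big(\bigotimes_i\mathbf{S}_{m_i}\big)\mathbin{;}\mathbf{S}_n\to\mathbf{S}_{\sum_{i,j}\ell_{i,j}}$, where $1\le i\le n$, $1\le j\le m_i$, obtained by composing the first two factors first or the last two factors first, agree). Since coalgebra maps are functions on state sets, and composition and tensor are cartesian product on state sets, these laws say exactly that the sets $S_n$ with these functions form a (non-symmetric, set-valued) operad. Distributions. For a finite set $X$, $\Delta^+_X:=\{\gamma\colon X\to(0,1]\mid\sum_{x\in X}\gamma(x)=1\}$. For $N\in\mathbb{N}$, $\Delta^+_N$ is the same definition with $N$ regarded as an $N$-element set (so $\Delta^+_0=\varnothing$). The set $\sum_i M_i$ is identified with the set of pairs $(i,j)$, $1\le i\le N$, $1\le j\le M_i$, in lexicographic order. For $\mu\in\Delta^+_N$ and $\gamma=(\gamma_1,\dots,\gamma_N)\in(\Delta^+_X)^N$, define $\mu\cdot\gamma\in\Delta^+_X$ by $(\mu\cdot\gamma)(x)=\sum_{i}\mu_i\gamma_i(x)$.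 The coalgebra $\mathbf{S}_N$. State set: $\Delta^+_N$. Action of $\mu\in\Delta^+_N$: the polynomial map $p_X^{\otimes N}\to p_X$ sending a position $\gamma\in(\Delta^+_X)^N$ to $\mu\cdot\gamma\in\Delta^+_X$, and, on directions at $\gamma$, sending $x\in X$ to $(x,\dots,x)\in X^N$. Update of $\mu$: for $\gamma\in(\Delta^+_X)^N$ and $x\in X$, the new state is $\gamma(x)*\mu\in\Delta^+_N$, defined by $$(\gamma(x)*\mu)_i=\frac{\gamma_i(x)\mu_i}{\sum_j\gamma_j(x)\mu_j}.$$ (For $N=0$ the state set is empty and there is nothing to define.) *)

(* Defs.v *)
From HB Require Import structures.
From mathcomp Require Import all_boot all_order all_algebra.
From mathcomp Require Import reals.

Set Implicit Arguments.
Unset Strict Implicit.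
Unset Printing Implicit Defensive.

Import Order.TTheory GRing.Theory Num.Theory.

Local Open Scope ring_scope.

(** * Polynomial functors *)

Record polyfun := PolyFun { ppos : Type; pdir : ppos -> Type }.

(* The value at A of the functor sum_I y^(pdir I). *)
Definition ext (p : polyfun) (A : Type) : Type := {I : ppos p & pdir I -> A}.

Definition ext_map (p : polyfun) (A B : Type) (f : A -> B) (u : ext p A) :
  ext p B := existT _ (projT1 u) (fun d => f (projT2 u d)).

Record polymap (p q : polyfun) := PMap {
  onpos :> ppos p -> ppos q;
  ondir : forall I : ppos p, pdir (onpos I) -> pdir I }.
Arguments ondir {p q} _ I _.

Definition polyid (p : polyfun) : polymap p p :=
  @PMap p p (fun I => I) (fun I d => d).

(* Diagrammatic order. *)
Definition polycomp (p q r : polyfun) (phi : polymap p q)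
    (psi : polymap q r) : polymap p r :=
  @PMap p r (fun I => psi (phi I))
            (fun I k => ondir phi I (ondir psi (phi I) k)).

(* The n-fold tensor product is taken in unbiased form: positions and
   directions are n-tuples of positions and directions.  For n = 0 it is the
   unit y. *)
Definition ptens (n : nat) (p : 'I_n -> polyfun) : polyfun :=
  @PolyFun (forall i, ppos (p i)) (fun I => forall i, pdir (I i)).

Definition ptens_map (n : nat) (p q : 'I_n -> polyfun)
    (phi : forall i, polymap (p i) (q i)) : polymap (ptens p) (ptens q) :=
  @PMap (ptens p) (ptens q) (fun I i => phi i (I i))
        (fun I d i => ondir (phi i) (I i) (d i)).

Definition ppow (p : polyfun) (n : nat) : polyfun := ptens (fun _ : 'I_n => p).

Definition phom (p q : polyfun) : polyfun :=
  @PolyFun (polymap p q) (fun phi => {I : ppos p & pdir (phi I)}).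

(* The canonical isomorphism between the tensor power of exponent 1 and p. *)
Definition ppow1 (p : polyfun) : polymap (ppow p 1) p :=
  @PMap (ppow p 1) p (fun I => I ord0)
    (fun I d i => eq_rect ord0 (fun i => pdir (I i)) d i (esym (ord1 i))).

(* The canonical isomorphism regrouping a (\sum_i m i)-fold tensor power into
   an n-fold tensor of m i-fold powers.  [tagnat] identifies 'I_(\sum_i m i)
   with the pairs (i, j), j < m i, in lexicographic order. *)
Definition ppow_split (p : polyfun) (n : nat) (m : 'I_n -> nat) :
    polymap (ppow p (\sum_i m i)%N) (ptens (fun i => ppow p (m i))) :=
  @PMap (ppow p (\sum_i m i)%N) (ptens (fun i => ppow p (m i)))
    (fun I i j => I (tagnat.Rank i j))
    (fun I d k => eq_rect _ (fun k => pdir (I k))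
       (d (tagnat.sig1 k) (tagnat.sig2 k)) k (tagnat.sig2K k)).

(** * Coalgebras *)

Record coalg (p : polyfun) := Coalg {
  state :> Type;
  step : state -> ext p state }.
Arguments step {p} _ _.

(* Commutation with the structure maps, as an equality of dependent pairs; for
   [phom p q] this is equality of actions and, over it, of updates. *)
Definition is_coalg_map (p : polyfun) (S T : coalg p) (f : S -> T) : Prop :=
  forall s, step T (f s) = ext_map f (step S s).

Definition act (p q : polyfun) (S : coalg (phom p q)) (s : S) : polymap p q :=
  projT1 (step S s).

Definition upd (p q : polyfun) (S : coalg (phom p q)) (s : S) (I : ppos p)
    (j : pdir (act s I)) : S :=
  projT2 (step S s) (existT _ I j).

Definition mk_coalg (p q : polyfun) (S : Type) (a : S -> polymap p q)
    (u : forall (s : S) (I : ppos p), pdir (a s I) -> S) : coalg (phom p q) :=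
  @Coalg (phom p q) S
    (fun s => existT _ (a s) (fun d => u s (projT1 d) (projT2 d))).

Definition id_coalg (p : polyfun) : coalg (phom p p) :=
  @mk_coalg p p unit (fun _ => polyid p) (fun _ _ _ => tt).

Definition coalg_comp (p q r : polyfun) (S : coalg (phom p q))
    (T : coalg (phom q r)) : coalg (phom p r) :=
  @mk_coalg p r (S * T)%type
    (fun st => polycomp (act st.1) (act st.2))
    (fun st I k =>
       (upd (ondir (act st.2) (act st.1 I) k), upd (I := act st.1 I) k)).

Definition coalg_tens (n : nat) (p q : 'I_n -> polyfun)
    (S : forall i, coalg (phom (p i) (q i))) :
    coalg (phom (ptens p) (ptens q)) :=
  @mk_coalg (ptens p) (ptens q) (forall i, S i)
    (fun s => ptens_map (fun i => act (s i)))
    (fun s I j i => upd (j i)).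

(* Transport of the domain interface along phi; only used when phi is one of
   the canonical isomorphisms [ppow1] and [ppow_split]. *)
Definition coalg_along (p' p q : polyfun) (phi : polymap p' p)
    (S : coalg (phom p q)) : coalg (phom p' q) :=
  @mk_coalg p' q S (fun s => polycomp phi (act s))
    (fun s I j => upd (I := phi I) j).

(** * Dynamic operads *)

Lemma sumn_ord1 (n : nat) : (\sum_(i < n) 1)%N = n.
Proof. by rewrite sum1_card card_ord. Qed.

Lemma sumn_1ord (n : nat) : (\sum_(i < 1) n)%N = n.
Proof. by rewrite big_ord1. Qed.

Lemma sumn_tagnat (n : nat) (m : 'I_n -> nat) (l : forall i, 'I_(m i) -> nat) :
  (\sum_(k < \sum_i m i) l (tagnat.sig1 k) (tagnat.sig2 k))%N
  = (\sum_i \sum_j l i j)%N.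
Proof.
rewrite (sig_big_dep xpredT (fun _ => xpredT) l).
by rewrite (reindex _ (onW_bij _ tagnat.sig_bij)).
Qed.

Section DynamicOperad.

Variables (p : polyfun) (S : forall n : nat, coalg (phom (ppow p n) p)).

Definition cast_state (a b : nat) (e : a = b) (s : S a) : S b :=
  eq_rect a (fun n => S n : Type) s b e.

Definition comp_dom (n : nat) (m : 'I_n -> nat) :
    coalg (phom (ppow p (\sum_i m i)%N) p) :=
  coalg_along (ppow_split p m)
    (coalg_comp (coalg_tens (fun i => S (m i))) (S n)).

Definition id_dom : coalg (phom (ppow p 1) p) :=
  coalg_along (ppow1 p) (id_coalg p).

(* The three laws are equations between functions on states, stated pointwise:
   the coherence isomorphisms between composites and tensors of coalgebras only
   rebracket tuples of states, and equalities between arities become casts. *)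
Record is_dynamic_operad (idn : id_dom -> S 1)
    (cmp : forall (n : nat) (m : 'I_n -> nat), comp_dom m -> S (\sum_i m i)%N) :
    Prop := {
  identitor_map : is_coalg_map idn;
  compositor_map :
    forall (n : nat) (m : 'I_n -> nat), is_coalg_map (@cmp n m);
  left_unit : forall (n : nat) (s : S n),
    cast_state (sumn_ord1 n) (cmp n (fun _ => 1%N) (fun _ => idn tt, s)) = s;
  right_unit : forall (n : nat) (s : S n),
    cast_state (sumn_1ord n) (cmp 1%N (fun _ => n) (fun _ => s, idn tt)) = s;
  associativity : forall (n : nat) (m : 'I_n -> nat)
      (l : forall i, 'I_(m i) -> nat)
      (u : forall i (j : 'I_(m i)), S (l i j))
      (t : forall i, S (m i)) (s : S n),
    cast_state (sumn_tagnat l)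
      (cmp _ (fun k => l (tagnat.sig1 k) (tagnat.sig2 k))
         (fun k => u (tagnat.sig1 k) (tagnat.sig2 k), cmp n m (t, s)))
    = cmp n (fun i => \sum_j l i j)%N (fun i => cmp (m i) (l i) (u i, t i), s) }.

End DynamicOperad.
Arguments is_dynamic_operad p S idn cmp : clear implicits.

(** * Distributions of full support *)

Section Distributions.

Variable R : realType.

Definition is_dist (X : finType) (g : {ffun X -> R}) : bool :=
  [forall x, 0 < g x <= 1] && (\sum_x g x == 1).

Record dist (X : finType) := Dist {
  dist_fun :> {ffun X -> R};
  dist_is_dist : is_dist dist_fun }.

HB.instance Definition _ (X : finType) := [isSub for @dist_fun X].

Lemma dist_gt0 (X : finType) (g : dist X) (x : X) : 0 < g x.
Proof. by case/andP: (dist_is_dist g) => /forallP /(_ x) /andP[]. Qed.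

Lemma dist_sum (X : finType) (g : dist X) : \sum_x g x = 1.
Proof. by case/andP: (dist_is_dist g) => _ /eqP. Qed.

Lemma is_dist_ffun (X : finType) (f : X -> R) :
  (forall x, 0 < f x) -> \sum_x f x = 1 -> is_dist [ffun x => f x].
Proof.
move=> f0 f1; have E : \sum_x [ffun x => f x] x = 1.
  by rewrite -f1; apply: eq_bigr => x _; rewrite ffunE.
rewrite /is_dist E eqxx andbT; apply/forallP => x; rewrite ffunE f0 /=.
by rewrite -f1 (bigD1 x) //= lerDl sumr_ge0 // => y _; rewrite ltW.
Qed.

Lemma dist_sum_gt0 (X : finType) (mu : dist X) (f : X -> R) :
  (forall x, 0 < f x) -> 0 < \sum_x f x * mu x.
Proof.
move=> f0; have ge0 x : 0 <= f x * mu x by rewrite ltW // mulr_gt0 // dist_gt0.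
rewrite lt_neqAle sumr_ge0 ?andbT // eq_sym; apply/eqP.
move/eqP; rewrite psumr_eq0 // => /allP f_mu0.
have := dist_sum mu; rewrite big1 => [/esym/eqP|x _]; first by rewrite oner_eq0.
by have := f_mu0 x (mem_index_enum x); rewrite gt_eqF // mulr_gt0 // dist_gt0.
Qed.

Lemma is_dist_mix (X : finType) (N : nat) (mu : dist 'I_N)
    (g : 'I_N -> dist X) :
  is_dist [ffun x => \sum_i mu i * g i x].
Proof.
apply: is_dist_ffun => [x|].
  under eq_bigr => i _ do rewrite mulrC.
  by apply: (dist_sum_gt0 mu) => i; apply: dist_gt0.
rewrite exchange_big -(dist_sum mu); apply: eq_bigr => i _.
by rewrite -mulr_sumr dist_sum mulr1.
Qed.

Definition dist_mix (X : finType) (N : nat) (mu : dist 'I_N)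
    (g : 'I_N -> dist X) : dist X := Dist (is_dist_mix mu g).

Lemma is_dist_bayes (X : finType) (N : nat) (g : 'I_N -> dist X) (x : X)
    (mu : dist 'I_N) :
  is_dist [ffun i => g i x * mu i / \sum_j g j x * mu j].
Proof.
have s0 := dist_sum_gt0 mu (fun i => dist_gt0 (g i) x).
apply: is_dist_ffun => [i|]; first by rewrite divr_gt0 // mulr_gt0 // dist_gt0.
by rewrite -mulr_suml divff // gt_eqF.
Qed.

Definition dist_bayes (X : finType) (N : nat) (g : 'I_N -> dist X) (x : X)
    (mu : dist 'I_N) : dist 'I_N := Dist (is_dist_bayes g x mu).

Lemma is_dist_one : is_dist [ffun _ : 'I_1 => 1 : R].
Proof. by apply: is_dist_ffun => [_|]; rewrite ?ltr01 // big_ord1. Qed.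

Definition dist_one : dist 'I_1 := Dist is_dist_one.

Lemma dist_one_unique (mu : dist 'I_1) : mu = dist_one.
Proof.
apply: val_inj; apply/ffunP => i; rewrite /= ffunE -(dist_sum mu) big_ord1.
by rewrite (ord1 i).
Qed.

Lemma is_dist_circ (N : nat) (M : 'I_N -> nat) (mu : dist 'I_N)
    (nu : forall i, dist 'I_(M i)) :
  is_dist [ffun k : 'I_(\sum_i M i)%N =>
    mu (tagnat.sig1 k) * nu (tagnat.sig1 k) (tagnat.sig2 k)].
Proof.
apply: is_dist_ffun => [k|]; first by rewrite mulr_gt0 // dist_gt0.
transitivity (\sum_i \sum_j mu i * nu i j).
  rewrite (sig_big_dep xpredT (fun _ => xpredT) (fun i j => mu i * nu i j)) /=.
  by rewrite (reindex _ (onW_bij _ tagnat.sig_bij)).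
rewrite -(dist_sum mu); apply: eq_bigr => i _.
by rewrite -mulr_sumr dist_sum mulr1.
Qed.

Definition dist_circ (N : nat) (M : 'I_N -> nat) (mu : dist 'I_N)
    (nu : forall i, dist 'I_(M i)) : dist 'I_(\sum_i M i)%N :=
  Dist (is_dist_circ mu nu).

(** * The prediction operad *)

Variable X : finType.

Definition pX : polyfun := @PolyFun (dist X) (fun _ => X).

Definition pred_act (N : nat) (mu : dist 'I_N) : polymap (ppow pX N) pX :=
  @PMap (ppow pX N) pX (fun g => dist_mix mu g) (fun g x i => x).

Definition pred_coalg (N : nat) : coalg (phom (ppow pX N) pX) :=
  @mk_coalg (ppow pX N) pX (dist 'I_N) (@pred_act N)
    (fun mu g x => dist_bayes g x mu).

Definition pred_idn : id_dom pX -> pred_coalg 1 := fun _ => dist_one.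

(* States of the domain are pairs (nu, mu), the inner distributions first. *)
Definition pred_cmp (N : nat) (M : 'I_N -> nat)
    (s : comp_dom pred_coalg M) : pred_coalg (\sum_i M i)%N :=
  dist_circ s.2 s.1.

End Distributions.

(* Main.v *)
(** A state mu is a prior over N sources and its update is Bayes' rule.  The
    compositor forms the joint prior mu_i nu_ij on pairs (i, j); that it
    commutes with actions is exchange of finite sums, and that it commutes with
    updates is the chain rule for posteriors: the posterior of the joint prior
    is the posterior of i, computed from the predictions marginalized over j,
    times the posterior of j given i.  Pointwise, the operad laws only say that
    multiplication in R is associative and unital, once the lexicographic
    indexings of the iterated sums of arities are matched. *)
Require Import Defs.
From mathcomp Require Import all_boot all_order all_algebra.
From mathcomp Require Import reals ring.
From Stdlib Require Import FunctionalExtensionality.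

Set Implicit Arguments.
Unset Strict Implicit.
Unset Printing Implicit Defensive.

Import Order.TTheory GRing.Theory Num.Theory.

Local Open Scope ring_scope.

Section Tagnat.

Variables (n : nat) (m : 'I_n -> nat).

(** The type of [tagnat.sig2] depends on [tagnat.sig1], so the two cancellations cannot be rewritten
    separately; the dependent [F] performs both at once, without transport. *)
Lemma tagnat_sigRank (A : Type) (F : forall i, 'I_(m i) -> A) i (j : 'I_(m i)) :
  F (tagnat.sig1 (tagnat.Rank i j)) (tagnat.sig2 (tagnat.Rank i j)) = F i j.
Proof. by rewrite /tagnat.sig2 /tagnat.sig1 /tagnat.Rank tagnat.rankK. Qed.

Lemma tagnat_ind (P : 'I_(\sum_i m i)%N -> Prop) :
  (forall i j, P (tagnat.Rank i j)) -> forall k, P k.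
Proof. by move=> PR k; rewrite -(tagnat.sig2K k). Qed.

Lemma big_tagnat (V : nmodType) (P : pred 'I_(\sum_i m i)%N)
    (F : 'I_(\sum_i m i)%N -> V) :
  \sum_(k | P k) F k
  = \sum_i \sum_(j | P (tagnat.Rank i j)) F (tagnat.Rank i j).
Proof.
rewrite (sig_big_dep xpredT (fun i j => P (tagnat.Rank i j))
  (fun i j => F (tagnat.Rank i j))) /=.
rewrite (reindex _ (onW_bij _ tagnat.rank_bij)) /=.
by apply: eq_big => [p|p _]; rewrite tagnat.rankE.
Qed.

Lemma ltn_Rank i (j : 'I_(m i)) i' (j' : 'I_(m i')) :
  (tagnat.Rank i' j' < tagnat.Rank i j)%N
  = (i' < i)%N || (i' == i) && (j' < j)%N.
Proof.
case: (eqVneq i' i) => [ei|ne] /=.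
  by subst i'; rewrite ltnn /=; exact: tagnat.lt_Rank.
rewrite orbF.
have := tagnat.lt_rank (Tagged (fun i => 'I_(m i)) j') (Tagged (fun i => 'I_(m i)) j).
rewrite Order.SigmaOrder.ltEsig /= !ltEord /= !leEord /= => ->.
by move: ne; rewrite -val_eqE; case: (ltngtP (val i') (val i)).
Qed.

(** Either rank is [x] plus the total size of the blocks that precede [(i, j)] lexicographically.
    The types of [x] and [x'] are equal only up to [tagnat_sigRank], hence the comparison in
    [nat]. *)
Lemma Rank_Rank (l : forall i, 'I_(m i) -> nat) i (j : 'I_(m i))
    (x : 'I_(l i j)) (x' : 'I_(l (tagnat.sig1 (tagnat.Rank i j))
                                 (tagnat.sig2 (tagnat.Rank i j)))) :
  x = x' :> nat ->
  tagnat.Rank (p_ := fun i => (\sum_j l i j)%N) i (tagnat.Rank j x)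
  = tagnat.Rank (p_ := fun k => l (tagnat.sig1 k) (tagnat.sig2 k))
      (tagnat.Rank i j) x' :> nat.
Proof.
move=> exx'; rewrite [LHS]tagnat.RankEsum [in LHS]tagnat.RankEsum.
rewrite [RHS]tagnat.RankEsum exx' addnA; congr (_ + _)%N.
rewrite (big_tagnat (V := nat)).
transitivity (\sum_(i' < n)
  \sum_(j' : 'I_(m i') | (i' < i)%N || (i' == i) && (j' < j)%N) l i' j')%N;
  last first.
  apply: eq_bigr => i' _; apply: eq_big => [j'|j' _]; first by rewrite ltn_Rank.
  by rewrite (tagnat_sigRank l).
(* The pairs before [(i, j)] are the full rows [i' < i] and, in row [i] itself, the columns
   [j' < j]. *)
rewrite [RHS](bigID (fun i' : 'I_n => i' < i)%N) /=; congr (_ + _)%N.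
  by apply: eq_bigr => i' ->.
rewrite (bigD1 i) ?ltnn //= [X in (_ + X)%N]big1 ?addn0 => [|i' /andP[]].
  by apply: eq_bigl => j'; rewrite eqxx.
by move=> /negbTE -> /negbTE ->; rewrite big_pred0.
Qed.

End Tagnat.

Section PredictionOperad.

Variables (R : realType) (X : finType).

(* The direction sets of [pX] do not depend on the position, so the components
   of such a step can be compared without transport. *)
Lemma eq_pX_step (p : polyfun) (S : Type) (f f' : ppos p -> dist R X)
    (d d' : forall I : ppos p, X -> pdir I) (u u' : {_ : ppos p & X} -> S) :
  f =1 f' -> (forall I x, d I x = d' I x) -> u =1 u' ->
  existT (fun phi : polymap p (pX R X) => pdir (phi : ppos (phom p (pX R X))) -> S)
    (@PMap p (pX R X) f d) u
  = existT _ (@PMap p (pX R X) f' d') u'.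
Proof.
move=> /functional_extensionality ef ed /functional_extensionality eu.
have ed' : d = d'.
  by apply: functional_extensionality_dep => I; apply: functional_extensionality.
by subst.
Qed.

Lemma cast_stateE (a b : nat) (e : a = b) (s : dist R 'I_a) (k : 'I_b) :
  (cast_state (S := @pred_coalg R X) e s : dist R 'I_b) k
  = s (cast_ord (esym e) k).
Proof. by case: b / e k => k; rewrite cast_ord_id. Qed.

Lemma eq_dist (Y : finType) (g h : dist R Y) : g =1 h -> g = h.
Proof. by move=> gh; apply: val_inj; apply/ffunP. Qed.

Lemma dist_circE (N : nat) (M : 'I_N -> nat) (mu : dist R 'I_N)
    (nu : forall i, dist R 'I_(M i)) i (j : 'I_(M i)) :
  dist_circ mu nu (tagnat.Rank i j) = mu i * nu i j.
Proof. by rewrite ffunE (tagnat_sigRank (fun i j => mu i * nu i j)). Qed.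

Lemma dist_mix_circ (N : nat) (M : 'I_N -> nat) (mu : dist R 'I_N)
    (nu : forall i, dist R 'I_(M i)) (g : 'I_(\sum_i M i)%N -> dist R X) :
  dist_mix (dist_circ mu nu) g
  = dist_mix mu (fun i => dist_mix (nu i) (fun j => g (tagnat.Rank i j))).
Proof.
apply: eq_dist => x; rewrite !ffunE big_tagnat.
apply: eq_bigr => i _; rewrite ffunE mulr_sumr.
by apply: eq_bigr => j _; rewrite dist_circE mulrA.
Qed.

(** With the normalizer displayed as a mixture, [dist_mix_circ] rewrites it and [dist_gt0] shows
    that it is nonzero. *)
Lemma dist_bayesE (N : nat) (g : 'I_N -> dist R X) (x : X) (mu : dist R 'I_N) i :
  dist_bayes g x mu i = g i x * mu i / dist_mix mu g x.
Proof. by rewrite !ffunE; under [in RHS]eq_bigr => j _ do rewrite mulrC. Qed.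

Lemma dist_bayes_circ (N : nat) (M : 'I_N -> nat) (mu : dist R 'I_N)
    (nu : forall i, dist R 'I_(M i)) (g : 'I_(\sum_i M i)%N -> dist R X) x :
  dist_bayes g x (dist_circ mu nu)
  = dist_circ
      (dist_bayes (fun i => dist_mix (nu i) (fun j => g (tagnat.Rank i j))) x mu)
      (fun i => dist_bayes (fun j => g (tagnat.Rank i j)) x (nu i)).
Proof.
apply: eq_dist; apply: tagnat_ind => i j.
rewrite dist_circE !dist_bayesE dist_mix_circ dist_circE.
(* The prediction [c] of group [i] multiplies the posterior of [i] and divides that of [j] given
   [i], so it cancels. *)
set c := dist_mix (nu i) _ x; have c0 : c != 0 by rewrite gt_eqF ?dist_gt0.
set D := dist_mix mu _ x; have D0 : D != 0 by rewrite gt_eqF ?dist_gt0.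
by field; rewrite c0 D0.
Qed.

Lemma pred_idn_map : is_coalg_map (@pred_idn R X).
Proof.
move=> s; apply: eq_pX_step => [I|I x|u].
- by apply: eq_dist => x; rewrite !ffunE big_ord1 ffunE mul1r.
(* The transport in [ppow1] runs in the constant family [X]. *)
- by apply: functional_extensionality_dep => i /=; rewrite rew_const.
- exact: dist_one_unique.
Qed.

Lemma pred_cmp_map (N : nat) (M : 'I_N -> nat) :
  is_coalg_map (@pred_cmp R X N M).
Proof.
move=> [nu mu]; apply: eq_pX_step => [I|I x|[I x]].
- exact: dist_mix_circ.
- by apply: functional_extensionality_dep => k /=; rewrite rew_const.
- exact: dist_bayes_circ.
Qed.

End PredictionOperad.

Theorem theorem4p1 (R : realType) (X : finType) :
  is_dynamic_operad (pX R X) (@pred_coalg R X) (@pred_idn R X) (@pred_cmp R X).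
Proof.
split.
- exact: pred_idn_map.
- exact: pred_cmp_map.
- move=> n s; apply: eq_dist => i; rewrite cast_stateE.
  have -> : cast_ord (esym (sumn_ord1 n)) i
            = tagnat.Rank (p_ := fun=> 1%N) i ord0.
    (* All blocks have size 1, so the offset of block [i] is [i]. *)
    apply: val_inj; rewrite /= [RHS]tagnat.RankEsum addn0.
    by rewrite -(big_ord_widen n (fun=> 1%N)) ?sumn_ord1 // ltnW.
  by rewrite dist_circE ffunE mulr1.
- move=> n s; apply: eq_dist => j; rewrite cast_stateE.
  have -> : cast_ord (esym (sumn_1ord n)) j
            = tagnat.Rank (p_ := fun=> n) ord0 j.
    by apply: val_inj; rewrite /= [RHS]tagnat.RankEsum big_pred0.
  by rewrite dist_circE ffunE mul1r.
- move=> n m l u t s; apply: eq_dist; apply: tagnat_ind => i.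
  apply: tagnat_ind => j x; rewrite cast_stateE.
  have el : l i j = l (tagnat.sig1 (tagnat.Rank i j))
                      (tagnat.sig2 (tagnat.Rank i j)).
    by rewrite tagnat_sigRank.
  have -> : cast_ord (esym (sumn_tagnat l)) (tagnat.Rank i (tagnat.Rank j x))
            = tagnat.Rank (p_ := fun k => l (tagnat.sig1 k) (tagnat.sig2 k))
                (tagnat.Rank i j) (cast_ord el x).
    by apply: val_inj; apply: Rank_Rank.
  rewrite !dist_circE mulrA; congr (_ * _).
  (* Quantifying over the equality [e] lets the cast move with the indices when [tagnat_sigRank] is
     applied to the predicate [P]. *)
  pose P i1 j1 := forall e : l i j = l i1 j1, u i1 j1 (cast_ord e x) = u i j x.
  have : P i j by move=> e; rewrite cast_ord_id.
  by rewrite -(tagnat_sigRank P); apply.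
Qed.
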